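(* Let $A\in\mathbb{R}^{n\times n}$ have all eigenvalues with negative real part, let $B\in\mathbb{R}^{n\times 1}$ (so the input is scalar, $m=1$), with $(A,B)$ controllable, and let $C_1\in\mathbb{R}^{p_1\times n}$, $C_2\in\mathbb{R}^{p_2\times n}$ with $p_1\ge p_2$. Consider the system $$\dot x(t)=Ax(t)+Bu(t),\quad x(0)=0,\quad y_i(t)=C_ix(t),\qquad i\in\{1,2\}$$ (i.e. $D_1=0$, $D_2=0$), with inputs $u\in\mathcal{L}_{2e}$. Let $Q_1=Q_1^\top\succeq0$ ($p_1\times p_1$), $R_2=R_2^\top\succeq0$ ($p_2\times p_2$) and $\delta_2>0$. For $i\in\{1,2\}$ and $j\in\{1,\dots,p_i\}$ let $r_{ij}$ denote the relative degree of the system from the input $u$ to the $j$-th component $y_{ij}$ of $y_i$, and define $$r_1^{\min}=\min_{j\in\{1,\dots,p_1\}}r_{1j},\qquad r_2^{\min}=\min_{j\in\{1,\dots,p_2\}}r_{2j}.$$ If $r_1^{\min}<r_2^{\min}$, then the semidefinite program $$\min_{\gamma,P}\ \gamma\delta_2\quad\text{s.t.}\quad \begin{bmatrix}A^\top P+PA & PB\\ B^\top P & 0\end{bmatrix}+\Gamma\preceq0,\quad\gamma\ge0,\quad P\in\mathbb{R}^{n\times n},\ P=P^\top\succeq0,$$ where $$\Gamma=\begin{bmatrix}C_1^\top\\ D_1^\top\end{bmatrix}Q_1\begin{bmatrix}C_1&D_1\end{bmatrix}-\gamma\begin{bmatrix}C_2^\top\\ D_2^\top\end{bmatrix}R_2\begin{bmatrix}C_2&D_2\end{bmatrix},\qquad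 D_1=0,\ D_2=0,$$ is infeasible.
   Context: Relative degree: for a strictly proper single-input single-output system with realization $(A,B,C,0)$, the relative degree is $r=\min\{k\in\mathbb{Z}_+ : CA^{k-1}B\neq0\}$, with $k\ge 1$ (the notation presupposes that this set is nonempty). For $y_{ij}$ the output matrix $C$ is the $j$-th row of $C_i$. $\mathcal{L}_{2e}$ is the set of signals $u:\mathbb{R}_+\to\mathbb{R}^m$ with $\int_0^{T}u(t)^\top u(t)\,dt<\infty$ for every $T\in\mathbb{R}_+$.
   Formalization: It is additionally assumed that Q_1 C_1 A^{r_1^min - 1} B ≠ 0 (automatic when Q_1 is positive definite); without such a condition the claim fails, e.g. for Q_1 = 0, where γ = 0, P = 0 is feasible. *)

(* Defs.v *)
From HB Require Import structures.
From mathcomp Require Import all_boot all_order all_algebra.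
From mathcomp Require Import complex reals.
Set Implicit Arguments.
Unset Strict Implicit.
Unset Printing Implicit Defensive.
Import Order.TTheory GRing.Theory Num.Theory.
Local Open Scope ring_scope.

Section Systems.
Variable R : realType.

(* mathcomp's eigenvalues are left eigenvalues; the spectrum is the same. *)
Definition hurwitz n (A : 'M[R]_n) : Prop :=
  forall z : R[i], eigenvalue (map_mx (real_complex R) A) z -> complex.Re z < 0.

Definition controllability_mx n m (A : 'M[R]_n) (B : 'M[R]_(n, m)) :=
  \mxrow_(k < n) (A ^+ k *m B).

Definition controllable n m (A : 'M[R]_n) (B : 'M[R]_(n, m)) : Prop :=
  \rank (controllability_mx A B) = n.

Definition is_least (S : nat -> Prop) (k : nat) : Prop :=
  S k /\ forall l, S l -> (k <= l)%N.

(* In particular this entails that some Markov parameter c A^(k-1) B is nonzero: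
   without one there is no relative degree. *)
Definition is_relative_degree n (A : 'M[R]_n) (B : 'cV[R]_n) (c : 'rV[R]_n)
    (r : nat) : Prop :=
  is_least (fun k => (1 <= k)%N /\ c *m A ^+ k.-1 *m B != 0) r.

(* The minimum of a family over 'I_p; it exists only if p > 0. *)
Definition is_minimum p (r : 'I_p -> nat) (k : nat) : Prop :=
  is_least (fun l => exists j, r j = l) k.

Definition psd n (M : 'M[R]_n) : Prop :=
  M^T = M /\ forall x : 'cV[R]_n, 0 <= (x^T *m M *m x) 0 0.

Definition nsd n (M : 'M[R]_n) : Prop := psd (- M).

Definition lmi_mx n m (A : 'M[R]_n) (B : 'M[R]_(n, m)) (P : 'M[R]_n) :
    'M[R]_(n + m) :=
  block_mx (A^T *m P + P *m A) (P *m B) (B^T *m P) 0.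

Definition supply_mx n m p1 p2
    (C1 : 'M[R]_(p1, n)) (D1 : 'M[R]_(p1, m))
    (C2 : 'M[R]_(p2, n)) (D2 : 'M[R]_(p2, m))
    (Q1 : 'M[R]_p1) (R2 : 'M[R]_p2) (gamma : R) : 'M[R]_(n + m) :=
  col_mx C1^T D1^T *m Q1 *m row_mx C1 D1
  - gamma *: (col_mx C2^T D2^T *m R2 *m row_mx C2 D2).

Record program (X : Type) := Program {
  objective : X -> R;
  feasible : X -> Prop
}.

Definition infeasible X (p : program X) : Prop := ~ exists x, feasible p x.

(* The decision variable is the pair (gamma, P); the objective is minimised. *)
Definition gain_sdp n m p1 p2
    (A : 'M[R]_n) (B : 'M[R]_(n, m))
    (C1 : 'M[R]_(p1, n)) (D1 : 'M[R]_(p1, m))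
    (C2 : 'M[R]_(p2, n)) (D2 : 'M[R]_(p2, m))
    (Q1 : 'M[R]_p1) (R2 : 'M[R]_p2) (delta2 : R) : program (R * 'M[R]_n) :=
  {| objective := fun x => x.1 * delta2;
     feasible := fun x =>
       [/\ nsd (lmi_mx A B x.2 + supply_mx C1 D1 C2 D2 Q1 R2 x.1),
           0 <= x.1
         & psd x.2] |}.

End Systems.

(* Main.v *)
(* The zero corner block of the LMI forces P B = 0. If P v = 0 and C2 v = 0, the
   quadratic form of the LMI at (v, 0) is v^T C1^T Q1 C1 v >= 0, so it vanishes
   and (v, 0) lies in the kernel of the LMI matrix: Q1 C1 v = 0 and P A v = 0.
   Starting from v = B, this propagates along A^k B as long as C2 A^k B = 0,
   hence up to k = r1min - 1, where Q1 C1 A^k B is nonzero. *)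
Require Import Defs.
From mathcomp Require Import all_boot all_order all_algebra.
From mathcomp Require Import complex reals.
From mathcomp Require Import lra.
Import Order.TTheory GRing.Theory Num.Theory.
Local Open Scope ring_scope.

Lemma trmx_mul_self_eq0 (R : realType) (n : nat) (x : 'cV[R]_n) :
  (x^T *m x) 0 0 = 0 -> x = 0.
Proof.
rewrite mxE => /eqP; rewrite psumr_eq0 => [/allP x0|i _]; last first.
  by rewrite mxE -expr2 sqr_ge0.
apply/colP => i; have := x0 i (mem_index_enum i).
by rewrite !mxE mulf_eq0 orbb => /eqP.
Qed.

(** A zero of a nonnegative form minimises it, so the gradient [2 M x] vanishes there. *)
Lemma psd_ker (R : realType) (n : nat) (M : 'M[R]_n) (x : 'cV[R]_n) :
  psd M -> (x^T *m M *m x) 0 0 = 0 -> M *m x = 0.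
Proof.
move=> [symM geM] xMx; set y := M *m x; apply: trmx_mul_self_eq0.
have yMx : y^T *m M *m x = y^T *m y by rewrite -mulmxA.
have xMy : x^T *m M *m y = y^T *m y by rewrite /y trmx_mul symM.
set a := (y^T *m y) 0 0; set b := (y^T *m M *m y) 0 0.
have b_ge0 : 0 <= b := geM y.
(* minimising the form along x - s y, up to the scaling s = a / (b + 1) *)
have := geM ((b + 1) *: x - a *: y).
have -> : ((b + 1) *: x - a *: y)^T = (b + 1) *: x^T - a *: y^T.
  by rewrite linearB !linearZ.
rewrite !(mulmxBl, mulmxBr) -!scalemxAl -!scalemxAr yMx xMy.
have scaleE (c : R) (m : 'M[R]_1) : (c *: m) 0 0 = c * m 0 0 by rewrite mxE.
have oppE (m : 'M[R]_1) : (- m) 0 0 = - m 0 0 by rewrite mxE.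
have addE (m p : 'M[R]_1) : (m + p) 0 0 = m 0 0 + p 0 0 by rewrite mxE.
rewrite !(addE, oppE, scaleE) xMx -/a -/b => form_ge0.
(* The form at the test vector is [- a ^+ 2 * (b + 2)], so its nonnegativity forces [a = 0]. Scaling
   by [b + 1] rather than [b] covers [b = 0]. *)
have a2b : 0 <= a ^+ 2 * b by rewrite mulr_ge0 ?sqr_ge0.
by apply/eqP; rewrite -sqrf_eq0 eq_le sqr_ge0 andbT; nra.
Qed.

Lemma is_minimum_le p (r : 'I_p -> nat) (k : nat) (j : 'I_p) :
  is_minimum r k -> (k <= r j)%N.
Proof. by case=> _; apply; exists j. Qed.

(** The power [A ^+ k] belongs to the Markov parameter of index [k.+1], which lies below the
    relative degree of every row. *)
Lemma markov_eq0 (R : realType) (n p : nat) (A : 'M[R]_n) (B : 'cV[R]_n)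
    (C : 'M[R]_(p, n)) (r : 'I_p -> nat) (rmin k : nat) :
  (forall j, is_relative_degree A B (row j C) (r j)) -> is_minimum r rmin ->
  (k.+1 < rmin)%N -> C *m (A ^+ k *m B) = 0.
Proof.
move=> rP rminP k_lt; apply/row_matrixP => j; rewrite row0 row_mul mulmxA.
apply/eqP/contraT => CAB; have [_ /(_ k.+1)] := rP j.
move=> /(_ (conj isT CAB)) /(leq_trans (is_minimum_le _ _ _ j rminP)).
by rewrite leqNgt k_lt.
Qed.

(** Without feedthrough the supply term reaches only the upper left block, so the lower right corner
    stays zero. *)
Lemma lmi_supplyE (R : realType) (n p1 p2 : nat) (A P : 'M[R]_n) (B : 'cV[R]_n)
    (C1 : 'M[R]_(p1, n)) (C2 : 'M[R]_(p2, n)) (Q1 : 'M[R]_p1) (R2 : 'M[R]_p2)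
    (gamma : R) :
  lmi_mx A B P + supply_mx C1 0 C2 0 Q1 R2 gamma =
  block_mx (A^T *m P + P *m A
            + (C1^T *m Q1 *m C1 - gamma *: (C2^T *m R2 *m C2))) (P *m B)
           (B^T *m P) 0.
Proof.
rewrite /lmi_mx /supply_mx !trmx0 !(mul_col_mx, mul_mx_row, mul0mx, mulmx0).
rewrite -!block_mxEh scale_block_mx
        opp_block_mx !add_block_mx.
by rewrite !scaler0 !subr0 !addr0.
Qed.

Theorem theorem6 (R : realType) (n p1 p2 : nat)
  (A : 'M[R]_n) (B : 'cV[R]_n) (C1 : 'M[R]_(p1, n)) (C2 : 'M[R]_(p2, n))
  (Q1 : 'M[R]_p1) (R2 : 'M[R]_p2) (delta2 : R)
  (r1 : 'I_p1 -> nat) (r2 : 'I_p2 -> nat) (r1min r2min : nat)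
  (A_hurwitz : hurwitz A)
  (AB_controllable : controllable A B)
  (le_p2_p1 : (p2 <= p1)%N)
  (Q1_psd : psd Q1)
  (R2_psd : psd R2)
  (delta2_gt0 : 0 < delta2)
  (r1P : forall j, is_relative_degree A B (row j C1) (r1 j))
  (r2P : forall j, is_relative_degree A B (row j C2) (r2 j))
  (r1minP : is_minimum r1 r1min)
  (r2minP : is_minimum r2 r2min)
  (* Q1 does not annihilate the leading Markov parameter of y1; automatic when
     Q1 is positive definite, and false e.g. for Q1 = 0 *)
  (Q1_weights_y1 : Q1 *m (C1 *m A ^+ r1min.-1 *m B) != 0)
  (lt_r1_r2 : (r1min < r2min)%N) :
  infeasible (gain_sdp A B C1 0 C2 0 Q1 R2 delta2).
Proof.
case=> -[gamma P] /= []; rewrite lmi_supplyE /nsd; set N := _ + _.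
move=> M_psd _ [symP P_ge0].
have PB : P *m B = 0.
  (* The vector (0, 1) evaluates the form at the zero corner; the upper block of its image is
     [- (P *m B)]. *)
  have := @psd_ker _ _ _ (col_mx (0 : 'cV_n) 1%:M) M_psd.
  rewrite tr_col_mx -mulmxA mulNmx mul_block_col !mulmx0 !mulmx1 !add0r.
  rewrite mulmxN mul_row_col trmx0 !(mul0mx, mulmx0) addr0 oppr0 mxE.
  by move=> /(_ erefl)/eqP; rewrite oppr_eq0 col_mx_eq0 => /andP[/eqP].
have step (v : 'cV[R]_n) : P *m v = 0 -> C2 *m v = 0 ->
    Q1 *m (C1 *m v) = 0 /\ P *m (A *m v) = 0.
  move=> Pv C2v.
  (* [P v = 0] removes [A^T P] from [N v]; its transpose removes [P A] from the form. *)
  have vP : v^T *m P = 0 by rewrite -[P]symP -trmx_mul Pv trmx0.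
  have Nv : N *m v = P *m (A *m v) + C1^T *m (Q1 *m (C1 *m v)).
    rewrite /N !mulmxDl mulNmx -scalemxAl -!mulmxA Pv C2v !mulmx0 scaler0.
    by rewrite add0r subr0.
  have vNv : v^T *m (N *m v) = (C1 *m v)^T *m Q1 *m (C1 *m v).
    by rewrite Nv mulmxDr mulmxA vP mul0mx add0r trmx_mul !mulmxA.
  have MvE : block_mx N (P *m B) (B^T *m P) 0 *m col_mx v (0 : 'cV_1) =
      col_mx (N *m v) 0.
    by rewrite mul_block_col !mulmx0 !addr0 -mulmxA Pv mulmx0.
  have vMv : (col_mx v (0 : 'cV_1))^T *m
      - block_mx N (P *m B) (B^T *m P) 0 *m col_mx v 0 =
      - ((C1 *m v)^T *m Q1 *m (C1 *m v)).
    by rewrite -mulmxA mulNmx MvE mulmxN tr_col_mx mul_row_col mulmx0 addr0 vNv.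
  (* Squeezed between [Q1_psd] and the sign of the LMI. *)
  have form0 : ((C1 *m v)^T *m Q1 *m (C1 *m v)) 0 0 = 0.
    apply/eqP; rewrite eq_le Q1_psd.2 andbT.
    by have := M_psd.2 (col_mx v 0); rewrite vMv mxE oppr_ge0.
  have Q1C1v : Q1 *m (C1 *m v) = 0 by apply: psd_ker.
  split=> //; have := @psd_ker _ _ _ (col_mx v (0 : 'cV_1)) M_psd.
  rewrite vMv mxE form0 oppr0 mulNmx MvE => /(_ erefl)/eqP.
  by rewrite oppr_eq0 col_mx_eq0 Nv Q1C1v mulmx0 addr0 => /andP[/eqP].
have C2AB k := markov_eq0 _ _ _ _ _ _ _ _ k r2P r2minP.
(* Passing from [k] to [k.+1] uses [C2 A^k B = 0], available exactly when [k.+1 < r2min]. *)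
have PAB k : (k < r2min)%N -> P *m (A ^+ k *m B) = 0.
  elim: k => [|k IH] k_lt; first by rewrite expr0 mul1mx.
  have [] := step _ (IH (ltnW k_lt)) (C2AB _ k_lt).
  by move=> _; rewrite exprS -mulmxE -mulmxA.
(* An index attaining the minimum shows [0 < r1min], so that [r1min.-1] is a true predecessor. *)
have [[j r1j] _] := r1minP.
have [[r1_gt0 _] _] := r1P j; rewrite r1j in r1_gt0.
have k_lt : (r1min.-1.+1 < r2min)%N by rewrite prednK.
have [Q1C1AB _] := step _ (PAB _ (ltnW k_lt)) (C2AB _ k_lt).
by move: Q1_weights_y1; rewrite -mulmxA Q1C1AB eqxx.
Qed.
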